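(* Let $T>0$ be fixed. Let $X$ be the telegraph process on $[0,T]$ with known velocity $v>0$ and $X(0)=0$, driven by a homogeneous Poisson process $N$ and observed at the times $t_i=i\Delta_n$, $i=0,\dots,n$. Let $\hat\lambda_n$ be the estimator defined as the solution of the approximate score equation $$\frac{\partial}{\partial\lambda}\log L_n(\lambda)\Big|_{\lambda=\hat\lambda_n}=0,$$ where $L_n$ is the approximate likelihood defined in the context. Under the condition $n\Delta_n=T$, as $\Delta_n\to 0$ (that is, $n\to\infty$), we have $$\hat\lambda_n\to\hat\lambda_\infty=\frac{N(T)}{T}.$$
   Context: Telegraph process: $X(t)=V(0)\int_0^t(-1)^{N(s)}\,ds$, where the initial velocity $V(0)$ takes the values $+v$ and $-v$ with equal probability, $v>0$ is known, and $N$ is a homogeneous Poisson process whose rate $\lambda>0$ is the unknown parameter to be estimated. $N(T)$ is the number of Poisson events (velocity switches) in $[0,T]$. Observations: $X_i=X(i\Delta_n)$, $i=0,\dots,n$, with $n\Delta_n=T$. Put $u_{n,i}=v^2\Delta_n^2-(X_i-X_{i-1})^2$ for $i=1,\dots,n$. Let $n^+$ be the number of indices $i\in\{1,\dots,n\}$ for which $u_{n,i}>0$ (observation intervals with at least one change of direction). Bessel functions: $I_\nu(x)=\sum_{k=0}^\infty\left(\frac{x}{2}\right)^{2k+\nu}\frac{1}{k!\,\Gamma(k+\nu+1)}$ is the modified Bessel function. Approximate likelihood (obtained by treating the increments $X_i-X_{i-1}$ as if they were $n$ independent copies of $X(\Delta_n)$): for $\lambda>0$, $$L_n(\lambda)=\frac{e^{-\lambda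 n\Delta_n}}{2^n}\,\frac{1}{v^{n^+}}\prod_{i:\,u_{n,i}>0}\left\{\lambda I_0\!\left(\frac{\lambda}{v}\sqrt{u_{n,i}}\right)+\frac{v\lambda\Delta_n\,I_1\!\left(\frac{\lambda}{v}\sqrt{u_{n,i}}\right)}{\sqrt{u_{n,i}}}\right\},$$ the product having $n^+$ factors. *)

(* Defs.v *)
From mathcomp Require Export all_boot all_order all_algebra.
From mathcomp Require Export all_classical all_reals all_analysis.
Export Order.TTheory GRing.Theory Num.Theory.
Export numFieldNormedType.Exports.

Set Implicit Arguments.
Unset Strict Implicit.
Unset Printing Implicit Defensive.

Local Open Scope classical_set_scope.
Local Open Scope ring_scope.

(* Sets of increments are arbitrary because every subset of nat is measurable;
   the subtraction on nat is not truncated because paths are nondecreasing.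
   No condition is put on N at negative times. *)
Record poisson_process (R : realType) (d : measure_display)
    (Omega : measurableType d) (P : probability Omega R)
    (lambda : R) (N : R -> {RV P >-> nat}) : Prop := PoissonProcess {
  poisson_init : forall w, N 0 w = 0%N ;
  poisson_nondecreasing : forall w s t, 0 <= s -> s <= t -> (N s w <= N t w)%N ;
  poisson_right_continuous : forall w t, 0 <= t ->
    \forall s \near t^'+, N s w = N t w ;
  poisson_increments : forall s t (k : nat), 0 <= s -> s < t ->
    P [set w | (N t w - N s w)%N = k] = (poisson_pmf (lambda * (t - s)) k)%:E ;
  poisson_independent : forall (m : nat) (t : nat -> R) (A : nat -> set nat),
    0 <= t 0%N -> (forall i, (i < m)%N -> t i <= t i.+1) ->
    P (\bigcap_(i in `I_m) [set w | A i (N (t i.+1) w - N (t i) w)%N]) =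
    (\prod_(i < m) P [set w | A i (N (t i.+1) w - N (t i) w)%N])%E
}.

Definition symmetric_velocity (R : realType) (d : measure_display)
    (Omega : measurableType d) (P : probability Omega R)
    (v : R) (V0 : {RV P >-> R}) : Prop :=
  P [set w | V0 w = v] = (2^-1)%:E /\ P [set w | V0 w = - v] = (2^-1)%:E.

Definition telegraph (R : realType) (Omega : Type)
    (V0 : Omega -> R) (N : R -> Omega -> nat) (t : R) (w : Omega) : R :=
  V0 w * \int[@lebesgue_measure R]_(s in `[0, t]) ((-1) ^+ N s w).

(* Modified Bessel function of integer order nu, for which
   Gamma (k + nu + 1) = (k + nu)!. *)
Definition besselI (R : realType) (nu : nat) (x : R) : R :=
  limn (series (fun k : nat =>
    (x / 2) ^+ (2 * k + nu) * (k`!%:R * (k + nu)`!%:R)^-1)).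

Section likelihood.
Context {R : realType}.
Variables (v Delta : R) (n : nat).
(* x i is the observation at time i * Delta. *)
Variable x : nat -> R.

(* Indices are shifted: obs_u i is $u_{n,i+1}$, for i = 0, ..., n - 1. *)
Definition obs_u (i : nat) : R :=
  v ^+ 2 * Delta ^+ 2 - (x i.+1 - x i) ^+ 2.

Definition nplus : nat := #|[pred i : 'I_n | 0 < obs_u i]|.

Definition approx_likelihood (l : R) : R :=
  expR (- l * n%:R * Delta) / 2 ^+ n * (1 / v ^+ nplus) *
  \prod_(i < n | 0 < obs_u i)
    (l * besselI 0 (l / v * Num.sqrt (obs_u i)) +
     v * l * Delta * besselI 1 (l / v * Num.sqrt (obs_u i))
       / Num.sqrt (obs_u i)).

End likelihood.

Definition score_root (R : realType) (L : R -> R) (l : R) : Prop :=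
  0 < l /\ is_derive l 1 (fun m : R => ln (L m)) 0.

(* When no u_{n,i} is positive, the score is the constant - n * Delta and has no
   root; L is then decreasing, and the estimate is its maximiser on [0, +oo[. *)
Definition score_estimate (R : realType) (L : R -> R) (l : R) : Prop :=
  score_root L l \/ ((forall m, ~ score_root L m) /\ l = 0).

(* Main.v *)
(* For l > 0 the derivative of log L_n at l is -T plus the sum, over the indices
   with u_{n,i} > 0, of 1/l + g_i'(l)/g_i(l), where l g_i(l) is the i-th factor
   of the likelihood.  Writing the Bessel functions through the series
   J_nu(y) = sum_k y^k / (k! (k + nu)!), which satisfy J_nu' = J_{nu+1} and
   J_nu = (nu + 1) J_{nu+1} + y J_{nu+2}, one finds
   0 <= g_i'/g_i <= Delta_n.  Hence the score has a root once n > n^+ >= 1 (by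
   the intermediate value theorem), and every root lies between n^+ / T and
   n^+ / (T - n^+ Delta_n).

   Almost surely N has only jumps of size 1 (on the grid of mesh T / m, the
   probability of a double jump is at most (lambda T)^2 / m) and no jump at a
   point of any of the countably many observation grids.  Then, as soon as
   Delta_n is smaller than the gaps between jump times, u_{n,i} > 0 exactly when
   N increases on the i-th interval, so that n^+ = N(T). *)
From mathcomp Require Import measurable_realfun zify ring lra.
Require Import Defs.

Set Implicit Arguments.
Unset Strict Implicit.
Unset Printing Implicit Defensive.

Local Open Scope classical_set_scope.
Local Open Scope ring_scope.

(** * Bessel functions as power series in the square of half the argument *)

Section bessel.
Context {R : realType}.
Implicit Types (nu k : nat) (x y : R).

Definition bessel_coeff nu k : R := (k`!%:R * (k + nu)`!%:R)^-1.

(** The function J_nu, with I_nu(x) = (x/2)^nu J_nu((x/2)^2). It is entire in y, so that no square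
    root has to be differentiated. *)
Definition bessel_series nu y : R := limn (pseries (bessel_coeff nu) y).

Lemma bessel_coeff_ge0 nu k : 0 <= bessel_coeff nu k.
Proof. by rewrite invr_ge0 mulr_ge0. Qed.

Lemma bessel_coeffS nu k :
  (k + nu.+1)%:R * bessel_coeff nu.+1 k = bessel_coeff nu k.
Proof.
rewrite /bessel_coeff addnS factS natrM.
rewrite mulrCA invfM mulrA divff ?mul1r// pnatr_eq0.
Qed.

Lemma pseries_diffs_bessel_coeff nu :
  pseries_diffs (bessel_coeff nu) = bessel_coeff nu.+1.
Proof.
apply/funext => k; rewrite /pseries_diffs /bessel_coeff factS natrM.
by rewrite -mulrA invfM mulrA divff ?mul1r ?pnatr_eq0// addSnnS.
Qed.

(** For z >= 0 the terms are dominated by those of exp z. Convergence at |y| + 1 then gives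
    convergence at y, which lies strictly inside the disc. *)
Lemma is_cvg_bessel_series nu y : cvgn (pseries (bessel_coeff nu) y).
Proof.
have ge0 z : 0 <= z -> cvgn (pseries (bessel_coeff nu) z).
  move=> z0; apply: (@series_le_cvg _ _ (exp_coeff z)).
  - by move=> k; rewrite mulr_ge0 ?bessel_coeff_ge0 ?exprn_ge0.
  - by move=> k; rewrite exp_coeff_ge0.
  - move=> k; rewrite /exp_coeff /bessel_coeff /= mulrC ler_wpM2l ?exprn_ge0//.
    by rewrite lef_pV2 ?posrE -?natrM ?ltr0n ?ler_nat ?muln_gt0 ?fact_gt0//
      leq_pmulr ?fact_gt0.
  - exact: is_cvg_series_exp_coeff.
apply: (@is_cvg_pseries_inside _ _ (`|y| + 1)); first by apply: ge0; rewrite addr_ge0.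
by rewrite [ltRHS]ger0_norm ?addr_ge0// ltrDl.
Qed.

Lemma is_derive_bessel_series nu y :
  is_derive y 1 (bessel_series nu) (bessel_series nu.+1 y).
Proof.
rewrite /bessel_series -(pseries_diffs_bessel_coeff nu).
apply: (@pseries_snd_diffs _ _ (`|y| + 1)); rewrite ?pseries_diffs_bessel_coeff;
  try exact: is_cvg_bessel_series.
by rewrite [ltRHS]ger0_norm ?addr_ge0// ltrDl.
Qed.

(** The coefficients satisfy c_nu(k) = (nu + 1) c_{nu+1}(k) + k c_{nu+1}(k), and the second part
    sums to y J_{nu+1}'(y) = y J_{nu+2}(y). *)
Lemma bessel_series_rec nu y :
  bessel_series nu y = nu.+1%:R * bessel_series nu.+1 y + y * bessel_series nu.+2 y.
Proof.
have c2 : cvgn (pseries (pseries_diffs (bessel_coeff nu.+1)) y).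
  by rewrite pseries_diffs_bessel_coeff; exact: is_cvg_bessel_series.
have := pseries_diffs_equiv c2.
rewrite pseries_diffs_bessel_coeff /= => c2'.
apply/cvg_lim => //.
rewrite (_ : pseries _ _ = fun n => nu.+1%:R * pseries (bessel_coeff nu.+1) y n +
  y * series (fun i => i%:R * bessel_coeff nu.+1 i * y ^+ i.-1) n); last first.
  apply/funext => n; rewrite /pseries /series /= !mulr_sumr -big_split/=.
  apply: eq_bigr => -[|k] _ /=.
    by rewrite -bessel_coeffS !mul0r mulr0 addr0 add0n mulrA.
  by rewrite -bessel_coeffS natrD exprS; ring.
apply: cvgD; apply: cvgMr => //; exact: is_cvg_bessel_series.
Qed.

Lemma bessel_series_gt0 nu y : 0 <= y -> 0 < bessel_series nu y.
Proof.
move=> y0; apply: (@lt_le_trans _ _ (pseries (bessel_coeff nu) y 1)).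
  rewrite /pseries /series /= big_nat1 expr0 mulr1 invr_gt0.
  by rewrite -natrM ltr0n muln_gt0 !fact_gt0.
apply: nondecreasing_cvgn_le; last exact: is_cvg_bessel_series.
apply: nondecreasing_series => k _ _.
by rewrite mulr_ge0 ?bessel_coeff_ge0 ?exprn_ge0.
Qed.

Lemma besselIE nu x :
  besselI nu x = (x / 2) ^+ nu * bessel_series nu ((x / 2) ^+ 2).
Proof.
apply/cvg_lim => //.
rewrite (_ : series _ = fun n =>
  (x / 2) ^+ nu * pseries (bessel_coeff nu) ((x / 2) ^+ 2) n); last first.
  apply/funext => n; rewrite /pseries /series /= mulr_sumr.
  by apply: eq_bigr => k _; rewrite exprD exprM /bessel_coeff; ring.
by apply: cvgMr => //; exact: is_cvg_bessel_series.
Qed.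

Lemma continuous_bessel_series nu : continuous (bessel_series nu).
Proof.
move=> y; apply/differentiable_continuous/derivable1_diffP.
by have [] := is_derive_bessel_series nu y.
Qed.

End bessel.

(** * One factor of the likelihood and its logarithmic derivative *)

Section likelihood_factor.
Context {R : realType}.
Variables (Delta b : R).
Implicit Type l : R.
Hypotheses (Delta_gt0 : 0 < Delta) (b_ge0 : 0 <= b) (b_le : 4 * b <= Delta ^+ 2).

(** With b = u / (4 v^2), the product [l * factor l] is the factor of the likelihood attached to u;
    the hypothesis [b_le] then says u <= v^2 Delta^2. *)
Definition factor (l : R) : R :=
  bessel_series 0 (b * l ^+ 2) + Delta * l / 2 * bessel_series 1 (b * l ^+ 2).

(* The derivative of [factor], with the term in J_2 eliminated by the recurrence:
   in this form the bound by [Delta * factor l] holds term by term. *)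
Definition dfactor (l : R) : R :=
  Delta * bessel_series 0 (b * l ^+ 2) +
  (2 * b * l - Delta / 2) * bessel_series 1 (b * l ^+ 2).

Definition factor_score (l : R) : R := dfactor l / factor l.

Lemma factor_gt0 l : 0 < l -> 0 < factor l.
Proof.
move=> l0; have y0 : 0 <= b * l ^+ 2 by rewrite mulr_ge0// exprn_ge0// ltW.
by rewrite addr_gt0 ?mulr_gt0 ?bessel_series_gt0.
Qed.

Lemma is_derive_factor (l : R) : is_derive l 1 factor (dfactor l).
Proof.
have dJ nu : is_derive l 1 (fun m : R => bessel_series nu (b * m ^+ 2))
    (2 * b * l * bessel_series nu.+1 (b * l ^+ 2)).
  have dq : is_derive l 1 (fun m : R => b * m ^+ 2) (2 * b * l).
    by apply: is_derive_eq; rewrite /GRing.scale /=; ring.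
  have dj := is_derive_bessel_series nu (b * l ^+ 2).
  have := @is_derive1_comp _ (bessel_series nu) (fun m : R => b * m ^+ 2) l _ _ dj dq.
  by rewrite mulrC.
have H := dJ 0%N; have H1 := dJ 1%N.
apply: is_derive_eq; rewrite /dfactor /GRing.scale /=.
by rewrite (bessel_series_rec 0); field.
Qed.

(** Upper bound: the J_0 terms of [dfactor] and [Delta * factor] agree, and the J_1 coefficients
    compare because 4 b <= Delta^2. Lower bound: expanding J_0 by the recurrence leaves only
    nonnegative terms. *)
Lemma factor_score_ge0_le l : 0 < l -> 0 <= factor_score l <= Delta.
Proof.
move=> l0; have y0 : 0 <= b * l ^+ 2 by rewrite mulr_ge0// exprn_ge0// ltW.
have J1 := bessel_series_gt0 1 y0; have J2 := bessel_series_gt0 2 y0.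
rewrite /factor_score divr_ge0 ?(ltW (factor_gt0 _))//=.
  rewrite ler_pdivrMr ?factor_gt0// /dfactor /factor.
  set j0 := bessel_series 0 _; set j1 := bessel_series 1 _ in J1 *.
  rewrite mulrDr lerD2l mulrA ler_wpM2r ?(ltW J1)//.
  have : 4 * b * l <= Delta ^+ 2 * l by rewrite ler_wpM2r// ltW.
  move: Delta_gt0; rewrite expr2 => D0 h; lra.
rewrite /dfactor (bessel_series_rec 0).
set j1 := bessel_series 1 _ in J1 *; set j2 := bessel_series 2 _ in J2 *.
rewrite (_ : _ + _ = 2 * b * l * j1 + Delta / 2 * j1 + Delta * (b * l ^+ 2 * j2));
  last by field.
by rewrite !addr_ge0// !mulr_ge0// ltW.
Qed.

Lemma continuous_factor_score l : 0 < l -> {for l, continuous factor_score}.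
Proof.
move=> l0.
have cJ nu : {for l, continuous (fun m : R => bessel_series nu (b * m ^+ 2))}.
  apply: (@continuous_comp _ _ _ (fun m : R => b * m ^+ 2)).
    by apply: cvgMr; exact: exprn_continuous.
  exact: continuous_bessel_series.
apply: cvgM; last first.
  apply: cvgV; first by rewrite gt_eqF ?factor_gt0.
  apply/differentiable_continuous/derivable1_diffP.
  by have [] := is_derive_factor l.
apply: cvgD; first by apply: cvgMr; exact: cJ.
apply: cvgM; last exact: cJ.
by apply: cvgB; [apply: cvgMr|apply: cvg_cst].
Qed.

End likelihood_factor.

Lemma ln_prod (R : realType) (I : Type) (r : seq I) (Q : pred I) (F : I -> R) :
  (forall i, Q i -> 0 < F i) ->
  ln (\prod_(i <- r | Q i) F i) = \sum_(i <- r | Q i) ln (F i).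
Proof.
move=> F0; suff [] : 0 < \prod_(i <- r | Q i) F i /\
  ln (\prod_(i <- r | Q i) F i) = \sum_(i <- r | Q i) ln (F i) by [].
elim/big_rec2: _ => [|i x y Qi [y0 yx]]; first by rewrite ln1.
by split; [rewrite mulr_gt0// F0|rewrite lnM ?posrE ?F0// yx].
Qed.

Lemma is_derive_bigsum (R : realType) (I : Type) (r : seq I) (Q : pred I)
    (h : I -> R -> R) (dh : I -> R) (x : R) :
  (forall i, Q i -> is_derive x 1 (h i) (dh i)) ->
  is_derive x 1 (fun y => \sum_(i <- r | Q i) h i y) (\sum_(i <- r | Q i) dh i).
Proof.
move=> hd; elim: r => [|i r IH].
  under eq_fun do rewrite big_nil.
  by rewrite big_nil; exact: is_derive_cst.
under eq_fun do rewrite big_cons.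
rewrite big_cons; case: ifP => // /hd hi; exact: is_deriveD.
Qed.

(** * The score, and the existence and location of its roots *)

Section score.
Context {R : realType}.
Variables (v Delta : R) (n : nat) (x : nat -> R).
Hypotheses (v_gt0 : 0 < v) (Delta_gt0 : 0 < Delta).
Implicit Type l : R.

Let u i := obs_u v Delta x i.
Let b i : R := u i / (4 * v ^+ 2).
Let T := n%:R * Delta.

Definition score l : R :=
  - T + \sum_(i < n | 0 < u i) (l^-1 + factor_score Delta (b i) l).

Let b_ge0 i : 0 < u i -> 0 <= b i.
Proof. by move=> ui; rewrite divr_ge0 ?(ltW ui)// mulr_ge0 ?sqr_ge0. Qed.

Let b_le i : 4 * b i <= Delta ^+ 2.
Proof.
have v2 : 0 < v ^+ 2 by rewrite exprn_gt0.
rewrite (_ : 4 * b i = u i / v ^+ 2); last first.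
  by rewrite /b; field; rewrite gt_eqF.
rewrite ler_pdivrMr// mulrC /u /obs_u.
have := sqr_ge0 (x i.+1 - x i); lra.
Qed.

(** The prefactor l sqrt(u) / (2 v) of I_1 cancels the division by sqrt(u). *)
Lemma likelihood_factorE i l : 0 < l -> 0 < u i ->
  l * besselI 0 (l / v * Num.sqrt (u i)) +
    v * l * Delta * besselI 1 (l / v * Num.sqrt (u i)) / Num.sqrt (u i)
  = l * factor Delta (b i) l.
Proof.
move=> l0 ui; rewrite !besselIE /factor.
have -> : (l / v * Num.sqrt (u i) / 2) ^+ 2 = b i * l ^+ 2.
  rewrite !expr_div_n exprMn expr_div_n sqr_sqrtr ?(ltW ui)// /b.
  by field; rewrite gt_eqF.
have s0 : Num.sqrt (u i) != 0 by rewrite sqrtr_eq0 -ltNge.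
by field; rewrite s0 gt_eqF.
Qed.

Lemma is_derive_loglikelihood l : 0 < l ->
  is_derive l 1 (fun m => ln (approx_likelihood v Delta n x m)) (score l).
Proof.
move=> l0.
(* [C] gathers what does not depend on the parameter; the existential keeps it opaque. *)
have [C CE] : exists C, C = 1 / v ^+ nplus v Delta n x / 2 ^+ n by eexists.
pose G m := ln C + (- T * m + \sum_(i < n | 0 < u i) (ln m + ln (factor Delta (b i) m))).
have GE m : 0 < m -> G m = ln (approx_likelihood v Delta n x m).
  move=> m0; rewrite /approx_likelihood.
  have C0 : 0 < C.
    by rewrite CE !divr_gt0 ?exprn_gt0.
  have fm i : 0 < u i -> 0 < factor Delta (b i) m.
    by move=> ui; apply: factor_gt0 => //; exact: b_ge0.
  have pE : \prod_(i < n | 0 < u i) (m * besselI 0 (m / v * Num.sqrt (u i)) +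
     v * m * Delta * besselI 1 (m / v * Num.sqrt (u i)) / Num.sqrt (u i)) =
     \prod_(i < n | 0 < u i) (m * factor Delta (b i) m).
    by apply: eq_bigr => i ui; rewrite likelihood_factorE.
  rewrite pE (_ : _ / _ * _ = C *
     expR (- T * m)); last first.
    by rewrite (_ : - T * m = - m * n%:R * Delta) /T ?CE; [field|ring];
      rewrite ?expf_neq0 ?gt_eqF.
  rewrite !lnM ?posrE ?mulr_gt0 ?expR_gt0//; last first.
    by apply: prodr_gt0 => i ui; rewrite mulr_gt0 ?fm.
  rewrite expRK ln_prod => [|i ui]; last by rewrite mulr_gt0 ?fm.
  rewrite /G addrA; congr (_ + _); apply: eq_bigr => i ui.
  by rewrite lnM ?posrE ?fm.
(* [G] is known to agree with the log-likelihood only at positive arguments, which suffices near l >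
   0. *)
apply: (@near_eq_is_derive _ _ _ G).
  by near=> m; apply: GE; near: m; exact: lt_nbhsr.
rewrite -[score l]add0r; apply: is_deriveD.
apply: is_deriveD; first by apply: is_derive_eq; rewrite /GRing.scale/= mulr1.
apply: is_derive_bigsum => i ui.
apply: is_deriveD; first exact: is_derive1_ln.
have f0 : 0 < factor Delta (b i) l by apply: factor_gt0 => //; exact: b_ge0.
have df := is_derive_factor Delta (b i) l.
have dl := is_derive1_ln f0.
have := @is_derive1_comp _ (@ln R) (factor Delta (b i)) l _ _ dl df.
by rewrite mulrC.
Unshelve. all: by end_near.
Qed.

Lemma score_rootP l : score_root (approx_likelihood v Delta n x) l <->
  0 < l /\ score l = 0.
Proof.
split=> -[l0 H]; split=> //; have D := is_derive_loglikelihood l0.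
  by rewrite -(@derive_val _ _ _ _ _ _ _ D) (@derive_val _ _ _ _ _ _ _ H).
by rewrite -H.
Qed.

Let K := nplus v Delta n x.

Lemma sum_score_bounds l : 0 < l ->
  K%:R / l <= \sum_(i < n | 0 < u i) (l^-1 + factor_score Delta (b i) l)
    <= K%:R / l + K%:R * Delta.
Proof.
move=> l0.
have cE c : \sum_(i < n | 0 < u i) c = K%:R * c.
  by rewrite sumr_const /K /nplus mulr_natl; congr (_ *+ _); apply: eq_card.
rewrite -mulrDr -!cE; apply/andP; split; apply: ler_sum => i ui;
  have /andP[s0 s1] := factor_score_ge0_le Delta_gt0 (b_ge0 ui) (b_le i) l0.
  by rewrite lerDl.
by rewrite lerD2l.
Qed.

Lemma continuous_score l : 0 < l -> {for l, continuous score}.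
Proof.
move=> l0; apply: cvgD; first exact: cvg_cst.
apply: cvg_big => [|i ui]; first exact: add_continuous.
apply: cvgD.
  by apply: cvgV; [rewrite gt_eqF|exact: cvg_id].
by apply: continuous_factor_score => //; exact: b_ge0.
Qed.

(** At a root the sum in the score equals T, so K/l <= T <= K/l + K Delta; both inequalities are
    solved for l. *)
Lemma score_root_bounds l : K%:R * Delta < T ->
  score_root (approx_likelihood v Delta n x) l ->
  K%:R / T <= l <= K%:R / (T - K%:R * Delta).
Proof.
move=> KT /score_rootP[l0 /eqP]; rewrite /score addrC subr_eq0 => /eqP E.
have := sum_score_bounds l0; rewrite E => /andP[].
have T0 : 0 < T by apply: le_lt_trans KT; rewrite mulr_ge0// ltW.
rewrite ler_pdivrMr// => h1; rewrite -lerBlDr ler_pdivlMr// => h2.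
by rewrite ler_pdivrMr// ler_pdivlMr ?subr_gt0// mulrC h1 mulrC h2.
Qed.

(** The same two bounds make the score nonnegative at K/T and nonpositive at K/(T - K Delta), and
    the score is continuous in between. *)
Lemma score_root_exists : (0 < K)%N -> K%:R * Delta < T ->
  exists l, score_root (approx_likelihood v Delta n x) l.
Proof.
move=> K0 KT.
have T0 : 0 < T by apply: le_lt_trans KT; rewrite mulr_ge0// ltW.
have a0 : 0 < K%:R / T by rewrite divr_gt0 ?ltr0n.
have TK : 0 < T - K%:R * Delta by rewrite subr_gt0.
have b0 : 0 < K%:R / (T - K%:R * Delta) by rewrite divr_gt0 ?ltr0n.
have KN : K%:R != 0 :> R by rewrite pnatr_eq0 -lt0n.
have ab : K%:R / T <= K%:R / (T - K%:R * Delta).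
  by rewrite ler_pM2l ?ltr0n// lef_pV2 ?posrE// gerBl mulr_ge0 ?(ltW Delta_gt0).
have sa : 0 <= score (K%:R / T).
  have /andP[+ _] := sum_score_bounds a0.
  by rewrite /score invf_div mulrCA divff// mulr1 [in X in _ -> X]addrC subr_ge0.
have sb : score (K%:R / (T - K%:R * Delta)) <= 0.
  have /andP[_ +] := sum_score_bounds b0.
  by rewrite /score invf_div mulrCA divff// mulr1 subrK [in X in _ -> X]addrC subr_le0.
have [| |c] := @IVT _ score _ _ 0 ab.
- apply: continuous_in_subspaceT => y; rewrite inE/= in_itv/= => /andP[ay _].
  by apply: continuous_score; exact: lt_le_trans ay.
- by rewrite ge_min sb orbT le_max sa.
rewrite in_itv/= => /andP[ac _] c0; exists c; apply/score_rootP; split=> //.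
exact: lt_le_trans ac.
Qed.

Lemma score_estimate_bounds l : K%:R * Delta < T ->
  score_estimate (approx_likelihood v Delta n x) l ->
  K%:R / T <= l <= K%:R / (T - K%:R * Delta).
Proof.
move=> KT [|[noroot ->]]; first exact: score_root_bounds.
(* Without a root K must be 0; both bounds are then 0, the conventional value of the estimate. *)
have [K0|K0] := posnP K; first by rewrite K0 !mul0r lexx.
by have [m /noroot] := score_root_exists K0 KT.
Qed.

End score.

(** * Increments of the telegraph path along a nondecreasing integer path *)

Section step_path.
Context {R : realType}.
Local Notation mu := (@lebesgue_measure R).
Variable f : R -> nat.
Hypothesis f_homo : forall s t : R, 0 <= s -> s <= t -> (f s <= f t)%N.

(** The integrand is bounded by 1, and it is measurable because the level sets of a monotone path
    are intervals. *)
Lemma integrable_sign_path t :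
  mu.-integrable `[0, t] (EFin \o (fun s => (-1) ^+ f s)).
Proof.
apply: measurable_bounded_integrable => //.
- by rewrite /= lebesgue_measure_itv/=; case: ifP => // _; rewrite -EFinB ltry.
- move=> _ Y mY.
  rewrite (_ : _ `&` _ = \bigcup_(k in [set k | Y ((-1) ^+ k)])
      (`[0, t] `&` f @^-1` [set k])); last first.
    apply/seteqP; split => [s [st Ys]|s [k Yk [st fsk]]].
      by exists (f s).
    by split=> //=; rewrite (fsk : f s = k).
  apply: bigcup_measurable => k _; apply: is_interval_measurable.
  move=> x y [/=]; rewrite !in_itv/= => /andP[x0 xt] fxk [] /andP[y0 yt] fyk z.
  move=> /andP[xz zy]; split.
    by rewrite in_itv/= (le_trans x0 xz) (le_trans zy yt).
  apply/eqP; rewrite eqn_leq; apply/andP; split.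
    by rewrite -(fyk : f y = k) f_homo// (le_trans x0 xz).
  by rewrite -(fxk : f x = k) f_homo.
- exists 1; split; first by rewrite num_real.
  by move=> M M1 s _ /=; rewrite normrX normrN1 expr1n ltW.
Qed.

Lemma Rintegral_const_itv (c d : bool) (x y : R) k :
  x <= y -> (forall s, s \in Interval (BSide c x) (BSide d y) -> f s = k) ->
  \int[mu]_(s in [set` Interval (BSide c x) (BSide d y)]) ((-1) ^+ f s) =
  (-1) ^+ k * (y - x).
Proof.
move=> xy fk; rewrite (@eq_Rintegral _ _ _ _ _ (fun=> (-1) ^+ k)); last first.
  by move=> s; rewrite inE/= => /fk ->.
rewrite Rintegral_cst//= lebesgue_measure_itv/= lte_fin.
move: xy; rewrite le_eqVlt => /predU1P[->|->//]; by rewrite ltxx subrr.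
Qed.

Let X t := \int[mu]_(s in `[0, t]) ((-1) ^+ f s).

Lemma sign_path_increment (a b : R) : 0 <= a -> a <= b ->
  X b - X a = \int[mu]_(s in `]a, b]) ((-1) ^+ f s).
Proof.
move=> a0 ab; rewrite /X Rintegral_itvB//.
  exact: integrable_sign_path.
Qed.

Lemma increment_no_jump (a b : R) : 0 <= a -> a <= b -> f b = f a ->
  X b - X a = (-1) ^+ f a * (b - a).
Proof.
move=> a0 ab fab; rewrite sign_path_increment//.
apply: (@Rintegral_const_itv false false) => //= s.
rewrite in_itv/= => /andP[/ltW as_ sb].
apply/eqP; rewrite eqn_leq -{1}fab !f_homo//.
exact: le_trans as_.
Qed.

(** The sign is constant on ]a, tau[ and opposite on [tau, b]. *)
Lemma increment_one_jump (a tau b : R) : 0 <= a -> a < tau -> tau <= b ->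
  f b = (f a).+1 -> (forall s, 0 <= s -> (f a < f s)%N = (tau <= s)) ->
  X b - X a = (-1) ^+ f a * ((tau - a) - (b - tau)).
Proof.
move=> a0 at_ tb fab ftau; rewrite sign_path_increment// ?(le_trans (ltW at_))//.
have iab : mu.-integrable `]a, b] (EFin \o (fun s => (-1) ^+ f s)).
  apply: integrableS (integrable_sign_path b) => //.
  by apply: subset_itv; rewrite bnd_simp.
rewrite (@itv_bndbnd_setU _ _ _ (BLeft tau)) ?bnd_simp// in iab *.
rewrite Rintegral_setU//=; last first.
  apply/disj_set2P/seteqP; split=> // s []/=.
  by rewrite !in_itv/= => /andP[_ st] /andP[ts _]; move: (lt_le_trans st ts); rewrite ltxx.
rewrite (@Rintegral_const_itv false true a tau (f a)) ?(ltW at_)//=; last first.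
  move=> s; rewrite in_itv/= => /andP[/ltW as_ st].
  have s0 : 0 <= s by exact: le_trans as_.
  by apply/eqP; rewrite eqn_leq (f_homo a0 as_) andbT leqNgt ftau// -ltNge.
rewrite (@Rintegral_const_itv true false tau b (f a).+1)//=; last first.
  move=> s; rewrite in_itv/= => /andP[ts sb].
  have s0 : 0 <= s by rewrite (le_trans a0)// (le_trans (ltW at_)).
  by apply/eqP; rewrite eqn_leq -{1}fab (f_homo s0 sb) ftau.
by rewrite exprS mulN1r mulNr -mulrBr.
Qed.

(** The time is the infimum of the s >= 0 with f s >= k. Right continuity makes it attained, and f 0
    = 0 < k makes it positive. *)
Lemma jump_time k T : f 0 = 0%N ->
  (forall t, 0 <= t -> \forall s \near t^'+, f s = f t) ->
  (0 < k)%N -> 0 <= T -> (k <= f T)%N ->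
  exists tau, [/\ 0 < tau, tau <= T & forall s, 0 <= s -> (k <= f s)%N = (tau <= s)].
Proof.
move=> f00 f_rc k0 T0 kT.
pose A := [set s : R | 0 <= s /\ (k <= f s)%N].
have AT : A T by [].
have lA : has_lbound A by exists 0 => s [].
have iA : has_inf A by split => //; exists T.
have inf0 : 0 <= inf A by apply: lb_le_inf; [exists T|move=> s []].
have leA s : 0 <= s -> (k <= f s)%N -> inf A <= s.
  by move=> s0 ks; apply: inf_lbound.
have Ak : (k <= f (inf A))%N.
  rewrite leqNgt; apply/negP => fk.
  have [e /= e0 He] := f_rc _ inf0.
  have [s As sl] := inf_adherent e0 iA.
  have [s0 ks] := As; have := leA _ s0 ks; rewrite le_eqVlt => /predU1P[E|ls].
    by move: ks; rewrite -E leqNgt fk.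
  suff fs : f s = f (inf A) by move: ks; rewrite fs leqNgt fk.
  apply: He => //; rewrite /ball_ /= ltr0_norm ?subr_lt0//.
  by rewrite opprB ltrBlDl.
exists (inf A); split.
- rewrite lt_neqAle inf0 andbT; apply/eqP => E.
  by move: Ak; rewrite -E f00 leqNgt k0.
- exact: leA.
- move=> s s0; apply/idP/idP => [/leA|is_]; first exact.
  exact: leq_trans Ak (f_homo _ _).
Qed.

End step_path.

(** * Paths with unit jumps off the grids: n^+ equals f T eventually *)

Section good_path.
Context {R : realType}.
Variables (f : R -> nat) (T : R).
Hypothesis f0 : f 0 = 0%N.
Hypothesis f_homo : forall s t : R, 0 <= s -> s <= t -> (f s <= f t)%N.
Hypothesis f_rc : forall t : R, 0 <= t -> \forall s \near t^'+, f s = f t.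
Hypothesis T_gt0 : 0 < T.

Local Notation grid n i := (i%:R * (T / n%:R)).

Lemma grid_ge0 n i : 0 <= grid n i.
Proof. by rewrite mulr_ge0// divr_ge0// ltW. Qed.

Lemma grid_last n : (0 < n)%N -> grid n n = T.
Proof. by move=> n0; rewrite mulrC divfK// pnatr_eq0 -lt0n. Qed.

Hypothesis f_simple : exists2 m, (0 < m)%N &
  forall i, (i < m)%N -> (f (grid m i.+1) <= (f (grid m i)).+1)%N.

(** Otherwise the first point of the grid of [f_simple] at or after tau1 would close a cell on which
    f grows by at least 2. *)
Lemma jump_times_distinct k tau1 tau2 : 0 < tau1 -> tau2 <= T ->
  (forall s, 0 <= s -> (k < f s)%N = (tau1 <= s)) ->
  (forall s, 0 <= s -> (k.+1 < f s)%N = (tau2 <= s)) ->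
  tau1 < tau2.
Proof.
move=> tau1_gt0 tau2T f1 f2; rewrite ltNge; apply/negP => tau21.
have [m m0 fm] := f_simple.
have tau1T : tau1 <= T.
  by rewrite -f1 ?(ltW T_gt0)// ltnW// f2// ltW.
pose Q i := tau1 <= grid m i.
have exQ : exists i, Q i by exists m; rewrite /Q grid_last.
case: (ex_minnP exQ) => -[|i] Qi mini.
  by move: Qi; rewrite /Q mul0r leNgt tau1_gt0.
have im : (i < m)%N by apply: mini; rewrite /Q grid_last.
have : (f (grid m i) <= k)%N.
  rewrite leqNgt f1 ?grid_ge0//; apply/negP => /mini.
  by rewrite ltnn.
have : (k.+1 < f (grid m i.+1))%N.
  by rewrite f2 ?grid_ge0// (le_trans tau21).
have := fm _ im; lia.
Qed.

(** Before T the path takes values at most f T, so delta can be a minimum over the finitely many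
    possible values of f a, built by induction. *)
Lemma jump_gap : exists2 delta, 0 < delta & forall a b, 0 <= a -> a <= b ->
  b <= T -> b - a < delta -> (f b <= (f a).+1)%N.
Proof.
suff [delta d0 H] : exists2 delta, 0 < delta & forall k, (k < (f T).+1)%N ->
    forall a b, f a = k -> 0 <= a -> a <= b ->
    b <= T -> b - a < delta -> (f b <= k.+1)%N.
  exists delta => // a b a0 ab bT; apply: H => //.
  by rewrite ltnS f_homo// (le_trans ab).
elim: (f T).+1 => [|K [delta d0 IH]]; first by exists 1.
suff [e e0 H] : exists2 e, 0 < e & forall a b, f a = K -> 0 <= a -> a <= b ->
    b <= T -> b - a < e -> (f b <= K.+1)%N.
  exists (Num.min delta e); first by rewrite lt_min d0.
  move=> k; rewrite ltnS leq_eqVlt => /predU1P[->|kK] a b fa a0 ab bT;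
    rewrite lt_min => /andP[bd be]; [exact: H be|exact: (IH _ kK _ _ fa)].
have [KT|KT] := leqP K.+2 (f T); last first.
  exists 1 => // a b _ a0 ab bT _.
  by rewrite -ltnS (leq_ltn_trans _ KT)// f_homo// (le_trans a0).
have [//|t2 [t20 t2T f2]] := jump_time f_homo f0 f_rc _ (ltW T_gt0) KT.
have [//|t1 [t10 t1T f1]] := jump_time f_homo f0 f_rc _ (ltW T_gt0) (ltnW KT).
(* t1 and t2 are the times of reaching K + 1 and K + 2: f a = K forces a < t1, and f b >= K + 2
   would force b >= t2. *)
exists (t2 - t1).
  by rewrite subr_gt0; exact: (@jump_times_distinct K).
move=> a b fa a0 ab bT bat; rewrite leqNgt f2 ?(le_trans a0)//.
apply/negP => t2b.
have : a < t1 by rewrite ltNge -f1// fa ltnn.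
lra.
Qed.

(** Up to the factor v^2, the left side is 0 without a jump and 4 (tau - a)(b - tau) with a jump at
    tau. The point s before b with f s = f b excludes tau = b. *)
Lemma increment_sqr_lt_jump (v V a b : R) : 0 < v -> V ^+ 2 = v ^+ 2 ->
  0 <= a -> a < b -> (f b <= (f a).+1)%N ->
  (exists s, [/\ 0 <= s, s < b & f s = f b]) ->
  let X t := V * \int[@lebesgue_measure R]_(s in `[0, t]) ((-1) ^+ f s) in
  (0 < v ^+ 2 * (b - a) ^+ 2 - (X b - X a) ^+ 2) = (f a < f b)%N.
Proof.
move=> v0 Vv a0 ab fab [s [s0 sb fs]] X; rewrite -mulrBr exprMn Vv -mulrBr.
rewrite pmulr_rgt0 ?exprn_gt0//.
have [fba|fba] := leqP (f b) (f a).
  have fE : f b = f a by apply/eqP; rewrite eqn_leq fba f_homo// ltW.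
  rewrite (increment_no_jump f_homo a0 (ltW ab) fE).
  by rewrite exprMn sqrr_sign mul1r subrr ltxx.
have fE : f b = (f a).+1 by apply/eqP; rewrite eqn_leq fab.
have b0 : 0 <= b by rewrite (le_trans a0)// ltW.
have [//|tau [tau0 taub ftau]] := jump_time f_homo f0 f_rc _ b0 fba.
have atau : a < tau by rewrite ltNge -ftau// ltnn.
have taub' : tau < b by apply: le_lt_trans sb; rewrite -ftau// fs.
rewrite (increment_one_jump f_homo a0 atau taub fE ftau).
rewrite exprMn sqrr_sign mul1r.
rewrite (_ : _ - _ = 4 * ((tau - a) * (b - tau))); last by ring.
by rewrite !mulr_gt0 ?subr_gt0.
Qed.

Hypothesis f_grid : forall n i, (0 < n)%N -> (0 < i)%N ->
  exists s, [/\ 0 <= s, s < grid n i & f s = f (grid n i)].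

Lemma nplus_eventually (v V : R) : 0 < v -> V ^+ 2 = v ^+ 2 ->
  \forall n \near \oo, nplus v (T / n%:R) n (fun i =>
    V * \int[@lebesgue_measure R]_(s in `[0, grid n i]) ((-1) ^+ f s)) = f T.
Proof.
move=> v0 Vv; have [delta d0 gap] := jump_gap.
have Tn : \forall n \near \oo, T / n%:R < delta.
  near=> n; rewrite ltr_pdivrMr; last by rewrite ltr0n; near: n; exact: nbhs_infty_gt.
  rewrite mulrC -ltr_pdivrMr//; near: n; exact: nbhs_infty_gtr.
near=> n.
have n0 : (0 < n)%N by near: n; exact: nbhs_infty_gt.
have nd : T / n%:R < delta by near: n.
have Tn0 : 0 < T / n%:R by rewrite divr_gt0 ?ltr0n.
have gridS i : grid n i.+1 - grid n i = T / n%:R.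
  by rewrite -mulrBl -natrB ?subSnn ?mul1r.
have gridlt i : grid n i < grid n i.+1 by rewrite -subr_gt0 gridS.
have step i : (i < n)%N -> (f (grid n i.+1) <= (f (grid n i)).+1)%N.
  move=> i_n; apply: gap; rewrite ?grid_ge0 ?(ltW (gridlt _)) ?gridS//.
  by rewrite -[leRHS](grid_last n0) ler_wpM2r ?(ltW Tn0)// ler_nat.
rewrite /nplus -sum1_card big_mkcond/=.
(* On a fine grid f grows by 0 or 1 on each cell, so the indicator of a positive u is the growth
   itself, and the sum telescopes. *)
rewrite (eq_bigr (fun i : 'I_n => f (grid n i.+1) - f (grid n i))%N); last first.
  move=> i _; rewrite inE /obs_u.
  have /= := increment_sqr_lt_jump v0 Vv (grid_ge0 n i) (gridlt i)
    (step _ (ltn_ord i)) (f_grid n0 (ltn0Sn i)).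
  rewrite gridS => ->.
  have := step _ (ltn_ord i).
  have := f_homo (grid_ge0 n i) (ltW (gridlt i)).
  by case: ltnP; lia.
rewrite -(big_mkord xpredT (fun i => f (grid n i.+1) - f (grid n i))%N).
rewrite (@telescope_sumn_in 0%N n (fun i => f (grid n i)))// => [|i _]; last first.
  exact: f_homo (grid_ge0 _ _) (ltW (gridlt i)).
by rewrite grid_last// mul0r f0 subn0.
Unshelve. all: by end_near. Qed.

End good_path.

(** * Almost sure properties of the velocity and of the Poisson paths *)

Section almost_sure.
Context {R : realType} {d : measure_display} {Omega : measurableType d}
  {P : probability Omega R}.

(** The intersection of covers of probability at most 1/(n+1) is a measurable null cover. *)
Lemma negligible_of_small_cover (A : set Omega) :
  (forall e : R, 0 < e -> exists B, [/\ measurable B, A `<=` B & (P B <= e%:E)%E]) ->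
  P.-negligible A.
Proof.
move=> H.
have /choice[B HB] (n : nat) : exists B, [/\ measurable B, A `<=` B &
    (P B <= (n.+1%:R^-1)%:E)%E] by apply: H; rewrite invr_gt0.
exists (\bigcap_n B n); split.
- by apply: bigcap_measurable => // n _; case: (HB n).
- apply/eqP; rewrite eq_le measure_ge0 andbT.
  apply/lee_addgt0Pr => e e0; rewrite add0e.
  have [n ne] : exists n : nat, n.+1%:R^-1 <= e.
    exists (Num.truncn e^-1); rewrite invf_ple ?posrE//.
    exact/ltW/truncnS_gt.
  have [mB _ PB] := HB n; apply: (le_trans _ (le_trans PB _)); last by rewrite lee_fin.
  apply: le_measure; rewrite ?inE//; last exact: bigcap_inf.
  by apply: bigcap_measurable => // k _; case: (HB k).
- by move=> w Aw n _; case: (HB n) => _ + _; apply.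
Qed.

Lemma symmetric_velocity_sqr (v : R) (V0 : {RV P >-> R}) : 0 < v ->
  symmetric_velocity v V0 -> {ae P, forall w, V0 w ^+ 2 = v ^+ 2}.
Proof.
move=> v0 [Vp Vn].
have mV c : measurable (V0 @^-1` [set c]) by exact: measurable_funPTI.
pose A := (V0 @^-1` [set v]) `|` (V0 @^-1` [set - v]).
have mA : measurable A by exact: measurableU.
exists (~` A); split; first exact: measurableC.
  rewrite probability_setC// measureU//; last first.
    apply/seteqP; split=> // w [/= -> E]; lra.
  rewrite [X in (_ - (X + _))%E]Vp [X in (_ - (_ + X))%E]Vn.
  have -> : ((2^-1)%:E + (2^-1)%:E = 1%:E :> \bar R)%E.
    by rewrite -EFinD; congr EFin; field.
  by rewrite subee.
by move=> w /= Vw [|] /= E; apply: Vw; rewrite E ?sqrrN.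
Qed.

Variables (lambda : R) (N : R -> {RV P >-> nat}).
Hypotheses (lambda_gt0 : 0 < lambda) (N_poisson : poisson_process lambda N).

(** The event is a countable union over the joint values of N s and N t. *)
Lemma measurable_increment s t (A : set nat) :
  measurable [set w | A (N t w - N s w)%N].
Proof.
rewrite (_ : mkset _ = \bigcup_a \bigcup_(b in [set b | A (b - a)%N])
  (N s @^-1` [set a] `&` N t @^-1` [set b])); last first.
  apply/seteqP; split => [w Aw|w [a _ [b /= Ab [/= -> ->]]]]//.
  by exists (N s w) => //; exists (N t w).
apply: bigcup_measurable => a _; apply: bigcup_measurable => b _.
by apply: measurableI; exact: measurable_funPTI.
Qed.

Lemma increment_pmf s t k : 0 <= s -> s < t ->
  P [set w | (N t w - N s w)%N = k] =
  ((lambda * (t - s)) ^+ k / k`!%:R * expR (- (lambda * (t - s))))%:E.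
Proof.
move=> s0 st; rewrite (poisson_increments N_poisson)// /poisson_pmf.
(* [poisson_pmf] tests whether its rate is positive. *)
by rewrite mulr_gt0// subr_gt0.
Qed.

Lemma increment_gt0_le s t : 0 <= s -> s < t ->
  (P [set w | (0 < N t w - N s w)%N] <= (lambda * (t - s))%:E)%E.
Proof.
move=> s0 st.
rewrite (_ : mkset _ = ~` [set w | (N t w - N s w)%N = 0%N]); last first.
  by apply/seteqP; split => w /=; rewrite lt0n => /eqP.
rewrite probability_setC; last exact: (@measurable_increment s t [set 0%N]).
rewrite increment_pmf// expr0 divr1 mul1r -EFinB lee_fin lerBlDr -lerBlDl.
exact: expR_ge1Dx.
Qed.

Lemma increment_gt1_le s t : 0 <= s -> s < t ->
  (P [set w | (1 < N t w - N s w)%N] <= ((lambda * (t - s)) ^+ 2)%:E)%E.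
Proof.
move=> s0 st.
rewrite (_ : mkset _ = ~` ([set w | (N t w - N s w)%N = 0%N] `|`
    [set w | (N t w - N s w)%N = 1%N])); last first.
  apply/seteqP; split => w /=; first by move=> + []; lia.
  by move=> /not_orP[]; lia.
have m0 := measurable_increment s t [set 0%N].
have m1 := measurable_increment s t [set 1%N].
rewrite probability_setC; last exact: measurableU.
rewrite measureU//; last by apply/seteqP; split => // w [/= ->].
rewrite [X in (_ - (X + _))%E](increment_pmf 0 s0 st).
rewrite [X in (_ - (_ + X))%E](increment_pmf 1 s0 st).
rewrite expr0 expr1 !divr1 mul1r -EFinD lee_fin.
set x := lambda * (t - s).
have x0 : 0 < x by rewrite mulr_gt0// subr_gt0.
(* From e^(-x) >= 1 - x one gets 1 - (1 + x) e^(-x) <= 1 - (1 + x)(1 - x) = x^2. *)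
have := expR_ge1Dx (- x); nra.
Qed.

Lemma ae_no_jump_at t : 0 < t ->
  {ae P, forall w, exists s, [/\ 0 <= s, s < t & N s w = N t w]}.
Proof.
move=> t0; apply: negligible_of_small_cover => e e0.
(* h <= t keeps t - h in the time domain, and h <= e / lambda bounds by e the probability of an
   increase between t - h and t. *)
pose h := Num.min t (e / lambda).
have h0 : 0 < h by rewrite lt_min t0 divr_gt0.
have s0 : 0 <= t - h by rewrite subr_ge0 ge_min lexx.
have st : t - h < t by rewrite ltrBlDr ltrDl.
exists [set w | (0 < N t w - N (t - h) w)%N]; split.
- exact: (@measurable_increment _ _ [set k | (0 < k)%N]).
- move=> w /= H; rewrite lt0n; apply/negP => /eqP E; apply: H; exists (t - h).
  split=> //; apply/eqP; rewrite eqn_leq -(subn_eq0 (N t w)) E eqxx andbT.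
  exact: (poisson_nondecreasing N_poisson w s0 (ltW st)).
- apply: (le_trans (increment_gt0_le s0 st)); rewrite lee_fin opprB addrC subrK.
  by rewrite mulrC -ler_pdivlMr// ge_min lexx orbT.
Qed.

Lemma ae_simple_on_grid T : 0 < T ->
  {ae P, forall w, exists2 m, (0 < m)%N & forall i, (i < m)%N ->
    (N (i.+1%:R * (T / m%:R)) w <= (N (i%:R * (T / m%:R)) w).+1)%N}.
Proof.
move=> T0; apply: negligible_of_small_cover => e e0.
(* This m exceeds (lambda T)^2 / e, so the union bound m (lambda T / m)^2 over the cells is at most
   e. *)
pose m := (Num.truncn ((lambda * T) ^+ 2 / e)).+1.
have m0 : 0 < m%:R :> R by rewrite ltr0n.
pose B i := [set w | (1 < N (i.+1%:R * (T / m%:R)) w - N (i%:R * (T / m%:R)) w)%N].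
have mB i : measurable (B i) by exact: (@measurable_increment _ _ [set k | (1 < k)%N]).
exists (\big[setU/set0]_(i < m) B i); split.
- exact: bigsetU_measurable.
- move=> w /= H; rewrite -bigcup_mkord; apply: contrapT => /= H'.
  apply: H; exists m => // i im; rewrite leqNgt; apply/negP => Bi.
  by apply: H'; exists i => //=; rewrite /B /=; lia.
- apply: (le_trans (@content_subadditive _ _ _ P _ B m _ _ _)) => //.
    exact: bigsetU_measurable.
  have PB i : (P (B i) <= ((lambda * (T / m%:R)) ^+ 2)%:E)%E.
    have dE : i.+1%:R * (T / m%:R) - i%:R * (T / m%:R) = T / m%:R.
      by rewrite -mulrBl -natrB ?subSnn ?mul1r.
    rewrite -dE; apply: increment_gt1_le.
      by rewrite mulr_ge0// divr_ge0// ltW.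
    by rewrite -subr_gt0 dE divr_gt0.
  apply: (@le_trans _ _ (\sum_(i < m) ((lambda * (T / m%:R)) ^+ 2)%:E)%E).
    by apply: lee_sum => i _; exact: PB.
  rewrite sumEFin lee_fin sumr_const card_ord -[leLHS]mulr_natl.
  have rE (c : R) : 0 < c -> c * (lambda * (T / c)) ^+ 2 = (lambda * T) ^+ 2 / c.
    by move=> c0; field; rewrite gt_eqF.
  rewrite rE// ler_pdivrMr// [leRHS]mulrC -ler_pdivrMr//.
  exact/ltW/truncnS_gt.
Qed.

End almost_sure.

(** * Convergence of the estimator by squeezing *)

Unset Implicit Arguments.

Theorem theorem2p1 (R : realType) (d : measure_display)
    (Omega : measurableType d) (P : probability Omega R)
    (T v lambda : R) (T_gt0 : 0 < T) (v_gt0 : 0 < v) (lambda_gt0 : 0 < lambda)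
    (N : R -> {RV P >-> nat}) (N_poisson : poisson_process lambda N)
    (V0 : {RV P >-> R}) (V0_symmetric : symmetric_velocity v V0)
    (Delta : nat -> R)
    (Delta_T : forall n : nat, (0 < n)%N -> n%:R * Delta n = T)
    (lambda_hat : nat -> Omega -> R)
    (lambda_hatP : forall (n : nat) (w : Omega), (0 < n)%N ->
      score_estimate
        (approx_likelihood v (Delta n) n
           (fun i : nat => telegraph V0 N (i%:R * Delta n) w))
        (lambda_hat n w)) :
  {ae P, forall w : Omega,
    (fun n : nat => lambda_hat n w) @ \oo --> (N T w)%:R / T}.
Proof.
have DeltaE n : (0 < n)%N -> Delta n = T / n%:R.
  by move=> n0; rewrite -(Delta_T n n0) mulrAC divff ?mul1r// pnatr_eq0 -lt0n.
(* The shifts [n.+1] and [i.+1] restrict to positive times; countability of the grid points allows a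
   common null set. *)
have grid : {ae P, forall w, forall n i, exists s,
    [/\ 0 <= s, s < i.+1%:R * (T / n.+1%:R) &
        N s w = N (i.+1%:R * (T / n.+1%:R)) w]}.
  apply/ae_foralln => n; apply/ae_foralln => i.
  by apply: (ae_no_jump_at lambda_gt0 N_poisson); rewrite mulr_gt0// divr_gt0.
have simple := ae_simple_on_grid lambda_gt0 N_poisson T_gt0.
have velocity := symmetric_velocity_sqr v_gt0 V0_symmetric.
apply: filterS3 grid simple velocity => w grid simple velocity.
have nplusE := @nplus_eventually R (fun s => N s w) T
  (poisson_init N_poisson w) (fun s t => poisson_nondecreasing N_poisson w (s := s) (t := t))
  (poisson_right_continuous N_poisson w) T_gt0 simple _ v (V0 w) v_gt0 velocity.
set K := N T w.
have Tn0 : (fun n => K%:R * (T / n%:R)) @ \oo --> (0 : R).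
  rewrite -(mulr0 K%:R) -(mulr0 T).
  by apply: cvgMr; apply: cvgMr; rewrite -cvg_shiftS; exact: cvg_harmonic.
(* Once n^+ = K, the estimate lies between these two bounds, and K Delta_n tends to 0. *)
apply: (@squeeze_cvgr _ _ _ _ (fun=> K%:R / T)
    (fun n => K%:R / (T - K%:R * (T / n%:R)))).
- near=> n.
  have n0 : (0 < n)%N by near: n; exact: nbhs_infty_gt.
  have nK : (K < n)%N by near: n; exact: nbhs_infty_gt.
  have D0 : 0 < T / n%:R by rewrite divr_gt0 ?ltr0n.
  have pE : nplus v (T / n%:R) n (fun i => telegraph V0 N (i%:R * (T / n%:R)) w) = K.
    near: n; apply: nplusE => -[//|n] [//|i] _ _; exact: grid.
  have := lambda_hatP n w n0; rewrite DeltaE// => /(score_estimate_bounds v_gt0 D0).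
  rewrite pE grid_last//; apply.
  (* The bounds require K Delta_n < T = n Delta_n, that is K < n. *)
  by rewrite -[ltRHS](grid_last T n0) ltr_pM2r// ltr_nat.
- exact: cvg_cst.
- suff : (fun n => K%:R / (T - K%:R * (T / n%:R))) @ \oo --> K%:R / (T - 0).
    by rewrite subr0.
  apply: cvgMr; apply: cvgV; first by rewrite subr0 gt_eqF.
  by apply: cvgB => //; exact: cvg_cst.
Unshelve. all: by end_near. Qed.
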